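(* The continuous bar induction ${\rm c\text{--}BI}$ is equivalent to the principle of Brouwer continuity ${\rm BC}$: each implies the other.
   Context: Work in Bishop-style constructive mathematics (no excluded middle), with countable choice $(\forall x\in\mathbb{N})(\exists\alpha\in\mathbb{N}^{\mathbb{N}})A(x,\alpha)\to(\exists F)(\forall x)A(x,F(x))$ and unique choice for functions $\mathbb{N}^{\mathbb{N}}\to\mathbb{N}$ (for decidable relations). Notation: $\mathbb{N}^*$ finite sequences of naturals, $a*b$ concatenation (also of a finite with an infinite sequence), $\langle\rangle$ empty sequence, $\langle n\rangle$ one-element sequence, $\overline{\alpha}n$ initial segment of length $n$, $|a|$ length, $0^\omega=\lambda x.0$. A predicate $P\subseteq\mathbb{N}^*$ is a bar if $(\forall\alpha\in\mathbb{N}^{\mathbb{N}})(\exists n)P(\overline{\alpha}n)$; a c--bar is a bar $P$ for which there is $\delta\colon\mathbb{N}^*\to\mathbb{N}$ with $P(a)\leftrightarrow(\forall b\in\mathbb{N}^* )\delta(a)=\delta(a*b)$ for all $a$. $Q\subseteq\mathbb{N}^*$ is inductive if $(\forall a)[(\forall n)Q(a*\langle n\rangle)\to Q(a)]$. ${\rm c\text{--}BI}$: for every c--bar $P$ and every predicate $Q\subseteq\mathbb{N}^*$, if $P\subseteq Q$ and $Q$ is inductive then $Q(\langle\rangle)$. The class $K$ of Brouwer-operations is the predicate on $\mathbb{N}^{\mathbb{N}^*}$ inductively defined (least class, with induction principle) by: (i) $\lambda a.\,n+1\in K$ for each $n$; (ii) if $\gamma(\langle\rangle)=0$ and $\lambda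 a.\,\gamma(\langle n\rangle*a)\in K$ for every $n$, then $\gamma\in K$. For $\gamma\in K$, $F_\gamma\colon\mathbb{N}^{\mathbb{N}}\to\mathbb{N}$ is $F_\gamma(\alpha)=\gamma(\overline{\alpha}m)-1$ with $m$ the least $z$ such that $\gamma(\overline{\alpha}z)>0$. $F$ is $K$-realisable if $F=F_\gamma$ for some $\gamma\in K$. $F\colon\mathbb{N}^{\mathbb{N}}\to\mathbb{N}$ is pointwise continuous if $(\forall\alpha)(\exists n)(\forall\beta)[\overline{\beta}n=\overline{\alpha}n\to F(\beta)=F(\alpha)]$. ${\rm BC}$: every pointwise continuous $F\colon\mathbb{N}^{\mathbb{N}}\to\mathbb{N}$ is $K$-realisable. *)

(* Defs.v *)
From mathcomp Require Import all_boot.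

Set Implicit Arguments.
Unset Strict Implicit.
Unset Printing Implicit Defensive.

(* The development is meant to be read in Rocq's intuitionistic logic: the two
   choice principles below are not available there by default, so they occur
   as explicit hypotheses.  The initial segment of length n of alpha is
   [mkseq alpha n]; finite sequences are read from left to right, so that
   a * <n> is [rcons a n] and <n> * a is [n :: a]. *)

Definition baire := nat -> nat.

Definition countable_choice : Prop :=
  forall A : nat -> baire -> Prop,
    (forall x, exists alpha, A x alpha) ->
    exists F : nat -> baire, forall x, A x (F x).

Definition unique_choice : Prop :=
  forall A : baire -> nat -> Prop,
    (forall alpha x, A alpha x \/ ~ A alpha x) ->
    (forall alpha, exists! x, A alpha x) ->
    exists F : baire -> nat, forall alpha, A alpha (F alpha).

Definition bar (P : seq nat -> Prop) : Prop :=
  forall alpha : baire, exists n, P (mkseq alpha n).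

Definition c_bar (P : seq nat -> Prop) : Prop :=
  bar P /\
  exists delta : seq nat -> nat,
    forall a, P a <-> (forall b, delta a = delta (a ++ b)).

Definition inductive (Q : seq nat -> Prop) : Prop :=
  forall a, (forall n, Q (rcons a n)) -> Q a.

Definition cBI : Prop :=
  forall P Q : seq nat -> Prop,
    c_bar P -> (forall a, P a -> Q a) -> inductive Q -> Q [::].

(* Functions are compared pointwise, so the base clause is closed under
   pointwise equality rather than requiring gamma to be syntactically
   [fun _ => n.+1]. *)
Inductive K : (seq nat -> nat) -> Prop :=
| K_const n gamma : (forall a, gamma a = n.+1) -> K gamma
| K_node gamma :
    gamma [::] = 0 -> (forall n, K (fun a => gamma (n :: a))) -> K gamma.

Lemma K_pos gamma :
  K gamma -> forall alpha : baire, exists z, 0 < gamma (mkseq alpha z).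
Proof.
elim=> [n {}gamma gammaE alpha | {}gamma _ _ IH alpha].
  by exists 0; rewrite gammaE.
have [z z_pos] := IH (alpha 0) (fun i => alpha i.+1).
exists z.+1; move: z_pos; congr (0 < gamma _).
by rewrite /mkseq /= -[1]/(1 + 0) iotaDl -map_comp.
Qed.

Definition Kfun gamma (Kgamma : K gamma) (alpha : baire) : nat :=
  (gamma (mkseq alpha (ex_minn (K_pos Kgamma alpha)))).-1.

Definition K_realisable (F : baire -> nat) : Prop :=
  exists gamma (Kgamma : K gamma), forall alpha, F alpha = Kfun Kgamma alpha.

Definition pointwise_continuous (F : baire -> nat) : Prop :=
  forall alpha : baire, exists n, forall beta : baire,
    mkseq beta n = mkseq alpha n -> F beta = F alpha.

Definition BC : Prop :=
  forall F : baire -> nat, pointwise_continuous F -> K_realisable F.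

(* Main.v *)
Require Import Defs.
From mathcomp Require Import all_boot.

Set Implicit Arguments.
Unset Strict Implicit.
Unset Printing Implicit Defensive.

(** From c-BI to BC: for a pointwise continuous F, the function
    delta a = F (a * 0^omega) makes "F is constant on a" a c-bar, and bar
    induction is applied to "F restricted to a is K-realisable".

    From BC to c-BI: let delta witness the c-bar P.  The limit of
    delta along alpha is a continuous function of alpha, but its constancy on a
    does not give P a, since delta may vary before reaching its limit.  So paths
    are allowed to stop: an entry m + 1 means "continue with m" and an entry 0
    means "stop here", freezing the value of delta.  If the
    resulting function F is constant on the code of a, then stopping after
    a * b for arbitrary b shows delta (a * b) = delta a, that is P a.  Induction
    on the Brouwer-operation realising F then proves Q. *)

Lemma mkseqD (T : Type) (f : nat -> T) m k :
  mkseq f (m + k) = mkseq f m ++ mkseq (fun i => f (m + i)) k.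
Proof.
by rewrite /mkseq iotaD map_cat add0n -{2}[m]addn0 iotaDl -map_comp.
Qed.

Lemma mkseq_nthD (T : Type) (x0 : T) s k :
  mkseq (nth x0 s) (size s + k) = s ++ nseq k x0.
Proof.
rewrite mkseqD mkseq_nth; congr (_ ++ _).
apply: (@eq_from_nth _ x0); rewrite size_mkseq ?size_nseq // => i lt_ik.
by rewrite nth_mkseq // nth_nseq lt_ik nth_default ?leq_addr.
Qed.

Lemma mkseq_nth_cat (T : Type) (x0 : T) s t :
  mkseq (nth x0 (s ++ t)) (size s) = s.
Proof.
apply: (@eq_from_nth _ x0) => [|i]; rewrite size_mkseq // => lt_i.
by rewrite nth_mkseq // nth_cat lt_i.
Qed.

Lemma eq_K gamma gamma' : K gamma -> gamma =1 gamma' -> K gamma'.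
Proof.
move=> Kg; elim: Kg gamma' => {gamma} [n gamma gE | gamma g0 _ IH] gamma' eg.
  by apply: (K_const (n := n)) => a; rewrite -eg gE.
by apply: K_node => [|n]; [rewrite -eg | apply: IH => a; apply: eg].
Qed.

(** A positive value can only come from a constant leaf, so it persists; hence [Kfun] may be read
    off at any positive stage, not only the least. *)
Lemma K_cat gamma : K gamma ->
  forall s t, 0 < gamma s -> gamma (s ++ t) = gamma s.
Proof.
elim=> {gamma} [n gamma gE s t _ | gamma g0 _ IH [|n s] t].
- by rewrite !gE.
- by rewrite g0.
- exact: IH.
Qed.

Lemma KfunE gamma (Kg : K gamma) alpha z :
  0 < gamma (mkseq alpha z) -> Kfun Kg alpha = (gamma (mkseq alpha z)).-1.
Proof.
rewrite /Kfun; case: ex_minnP => m gm min_m gz.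
by rewrite -(subnKC (min_m z gz)) mkseqD K_cat.
Qed.

Section cBI_to_BC.

Hypothesis AC : countable_choice.

(** Sequences are coded as naturals by [pickle]. Decoding recovers [g] only pointwise, hence the
    extensionality condition on [A]. *)
Lemma countable_choice_seq (A : nat -> (seq nat -> nat) -> Prop) :
    (forall x g g', g =1 g' -> A x g -> A x g') ->
    (forall x, exists g, A x g) ->
  exists G : nat -> seq nat -> nat, forall x, A x (G x).
Proof.
move=> extA exA.
have [x|F AF] := @AC (fun x alpha => A x (fun s => alpha (pickle s))).
  have [g Ag] := exA x.
  exists (fun k => if unpickle k is Some s then g s else 0).
  by apply: extA Ag => s; rewrite pickleK.
by exists (fun x s => F x (pickle s)).
Qed.

(** Here [gamma] reads only what follows [a]; admitting every positive stage keeps minimality out of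
    the induction. *)
Definition K_realisable_on (F : baire -> nat) (a : seq nat) : Prop :=
  exists2 gamma, K gamma &
    forall beta z s, mkseq beta z = a ++ s -> 0 < gamma s ->
      F beta = (gamma s).-1.

Lemma K_realisable_on_nil F : K_realisable_on F [::] -> K_realisable F.
Proof.
case=> gamma Kg Fg; exists gamma, Kg => alpha.
rewrite /Kfun; case: ex_minnP => m gm _; exact: (Fg _ m).
Qed.

Lemma inductive_K_realisable_on F : inductive (K_realisable_on F).
Proof.
move=> a exg.
have [n g g' eg [Kg Fg]|n|G KG] := @countable_choice_seq (fun n g => K g /\
    forall beta z s, mkseq beta z = rcons a n ++ s -> 0 < g s ->
      F beta = (g s).-1).
- split=> [|beta z s]; first exact: eq_K Kg eg.
  by rewrite -eg; apply: Fg.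
- by have [g Kg Fg] := exg n; exists g.
exists (fun s => if s is n :: t then G n t else 0).
  by apply: K_node => // n; case: (KG n).
move=> beta z [//|n s] betaE; have [_ FG] := KG n.
by apply: (FG _ z); rewrite cat_rcons.
Qed.

Lemma cBI_BC : cBI -> BC.
Proof.
move=> BI F contF; apply: K_realisable_on_nil.
pose delta a := F (nth 0 a).
apply: (BI (fun a => forall b, delta a = delta (a ++ b))).
- split; last by exists delta.
  move=> alpha; have [n Fn] := contF alpha; exists n => b.
  rewrite /delta (Fn (nth 0 (mkseq alpha n ++ b))).
    by apply: Fn; rewrite -{2}(size_mkseq alpha n) mkseq_nth.
  by rewrite -{2}(size_mkseq alpha n) mkseq_nth_cat.
- move=> a Pa; exists (fun=> (delta a).+1) => [|beta z s betaE _ /=].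
    exact: (K_const (n := delta a)).
  (* [Pa] concerns only sequences ending in zeros. By continuity a long segment [t] of [beta] can
     replace [beta]; length at least [z] makes [t] extend [a]. *)
  have [n Fn] := contF beta.
  pose t := mkseq beta (n + z).
  have <- : delta t = F beta.
    by apply: Fn; rewrite /t mkseqD -{3}(size_mkseq beta n) mkseq_nth_cat.
  by rewrite /t addnC mkseqD betaE -catA -Pa.
- exact: inductive_K_realisable_on.
Qed.

End cBI_to_BC.

Section BC_to_cBI.

Hypothesis UC : unique_choice.

(* The finite sequence coded by s: entries m.+1 mean m, the first 0 ends it. *)
Definition stop (s : seq nat) : seq nat :=
  map predn (take (find (pred1 0) s) s).

Lemma stop_nseq c k : stop (map succn c ++ nseq k 0) = c.
Proof.
rewrite /stop; elim: c => [|n c IHc] /=; first by case: k.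
by rewrite IHc.
Qed.

Lemma stop_cat_has s t : has (pred1 0) s -> stop (s ++ t) = stop s.
Proof.
by move=> has0; rewrite /stop find_cat has0 takel_cat ?find_size.
Qed.

Lemma stop_cat_hasN s t : ~~ has (pred1 0) s ->
  stop (s ++ t) = map predn s ++ stop t.
Proof.
move=> hasN0; rewrite /stop find_cat (negPf hasN0) take_cat.
by rewrite ltnNge leq_addr /= addKn map_cat.
Qed.

Section StoppedLimit.

Variables (P : seq nat -> Prop) (delta : seq nat -> nat).
Hypothesis barP : bar P.
Hypothesis deltaP : forall a, P a <-> (forall b, delta a = delta (a ++ b)).

(** Either [s] already contains a stop mark, or both stopped sequences extend [map predn s], beyond
    which [delta] is constant. *)
Lemma delta_stop_cat s t :
  P (map predn s) -> delta (stop (s ++ t)) = delta (stop s).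
Proof.
move/deltaP => Ps; have [has0|hasN0] := boolP (has (pred1 0) s).
  by rewrite stop_cat_has.
by rewrite -{2}[s]cats0 !stop_cat_hasN // -!Ps.
Qed.

(** Membership in [P] is tested with stop marks read as 0, so that [barP] supplies a stage even for
    stopped paths. *)
Definition stopped_limit (beta : baire) (x : nat) : Prop :=
  exists2 n, P (map predn (mkseq beta n)) & x = delta (stop (mkseq beta n)).

Lemma stopped_limit_ex beta : exists x, stopped_limit beta x.
Proof.
have [n Pn] := barP (fun i => (beta i).-1).
exists (delta (stop (mkseq beta n))), n => //.
by rewrite /mkseq -map_comp.
Qed.

Lemma stopped_limit_unique beta x y :
  stopped_limit beta x -> stopped_limit beta y -> x = y.
Proof.
move=> [n Pn ->] [m Pm ->].
rewrite -(delta_stop_cat (mkseq (fun i => beta (n + i)) m) Pn) -mkseqD addnC.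
by rewrite mkseqD delta_stop_cat.
Qed.

Lemma stopped_limit_fun :
  exists F : baire -> nat, forall beta, stopped_limit beta (F beta).
Proof.
apply: UC => [beta x | beta]; have [y Ly] := stopped_limit_ex beta.
  have [->|neq_xy] := eqVneq x y; [by left | right => Lx].
  by move/eqP: neq_xy; apply; apply: stopped_limit_unique Lx Ly.
by exists y; split=> // x; apply: stopped_limit_unique.
Qed.

(** The default 0 of [nth] acts as the stop mark, and stage [n + k] lies past all of [c]. *)
Lemma stopped_limit_nth c x :
  stopped_limit (nth 0 (map succn c)) x -> x = delta c.
Proof.
set beta := nth 0 _; set k := size (map succn c); case=> n Pn ->.
rewrite -(delta_stop_cat (mkseq (fun i => beta (n + i)) k) Pn) -mkseqD addnC.
by rewrite mkseq_nthD stop_nseq.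
Qed.

Lemma pointwise_continuous_stopped_limit F :
  (forall beta, stopped_limit beta (F beta)) -> pointwise_continuous F.
Proof.
move=> LF alpha; have [n Pn _] := LF alpha; exists n => beta eq_n.
apply: (@stopped_limit_unique beta) => //.
exists n; rewrite eq_n //; apply: (@stopped_limit_unique alpha) => //.
by exists n.
Qed.

Lemma Kfun_stopped_limit F gamma (Kg : K gamma) a :
    (forall beta, stopped_limit beta (F beta)) ->
    (forall beta, F beta = Kfun Kg beta) ->
  0 < gamma (map succn a) -> P a.
Proof.
move=> LF Fg ga; apply/deltaP => b.
have delta_cat c : delta (a ++ c) = (gamma (map succn a)).-1.
  have eq_a : mkseq (nth 0 (map succn (a ++ c))) (size (map succn a))
               = map succn a.
    by rewrite map_cat mkseq_nth_cat.
  rewrite -(@stopped_limit_nth (a ++ c) _ (LF _)) Fg.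
  by rewrite (@KfunE _ _ _ (size (map succn a))) eq_a.
by rewrite -{1}[a]cats0 !delta_cat.
Qed.

End StoppedLimit.

(** Only the branches [n.+1] of [gamma] are followed, since 0 codes no entry; [a] records the path
    decoded so far. *)
Lemma K_bar_induction Q gamma : inductive Q -> K gamma ->
  forall a, (forall b, 0 < gamma (map succn b) -> Q (a ++ b)) -> Q a.
Proof.
move=> indQ; elim=> {gamma} [n gamma gE a Qa | gamma _ _ IH a Qa].
  by rewrite -[a]cats0; apply: Qa; rewrite gE.
by apply: indQ => n; apply: (IH n.+1) => b gb; rewrite cat_rcons; apply: Qa.
Qed.

Lemma BC_cBI : BC -> cBI.
Proof.
move=> bc P Q [barP [delta deltaP]] subPQ indQ.
have [F LF] := stopped_limit_fun barP deltaP.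
have [gamma [Kg Fg]] := bc F (pointwise_continuous_stopped_limit deltaP LF).
apply: (K_bar_induction indQ Kg) => b gb; apply: subPQ.
exact: Kfun_stopped_limit LF Fg gb.
Qed.

End BC_to_cBI.

Theorem theorem4p1 (AC : countable_choice) (UC : unique_choice) : cBI <-> BC.
Proof. by split; [apply: cBI_BC | apply: BC_cBI]. Qed.
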